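(* Let $\Omega\Subset\mathbb{C}^n$ be a domain, let $\nu$ be a finite Borel measure on $b\Omega$ with support $T=\operatorname{supp}(\nu)$, and let $V$ be an irreducible, minimally defined germ of an analytic hypersurface in $\overline\Omega$ such that $\Omega\cap V\neq\emptyset$ and $\nu(T\cap V)=0$. Put $\Omega^*=\Omega\setminus V$. Then the following hold. (1) If $\mathcal{A}(\Omega,\nu)$ is weakly admissible, then $\mathcal{A}_k(\Omega^*,\nu)$ is weakly admissible for every $k\in\mathbb{N}_0$. (2) If $\mathcal{A}(\Omega,\nu)$ is strongly admissible, then $\mathcal{A}_k(\Omega^*,\nu)$ is strongly admissible for every $k\in\mathbb{N}_0$.
   Context: Admissibility. Let $D\Subset\mathbb{C}^n$ be a domain, $\nu$ a finite Borel measure on the topological boundary $bD$, $T=\operatorname{supp}\nu$. A family $\mathcal{F}$ of complex-valued functions on $D\cup T$ is weakly admissible if (i) $F|_T\in L^2(\nu)$ for all $F\in\mathcal{F}$, and (ii) for every compact $K\subset D$ there is $C_K>0$ with $\sup_{z\in K}|F(z)|\le C_K\|F|_T\|_{L^2(\nu)}$ for all $F\in\mathcal{F}$. A weakly admissible family $\mathcal{F}$ is strongly admissible if, for every sequence $\{F_n\}\subset\mathcal{F}$ such that $\{F_n|_T\}$ is Cauchy in $L^2(\nu)$ and $F_n\to 0$ uniformly on compact subsets of $D$, one has $F_n|_T\to 0$ in $L^2(\nu)$. Germs. For $K\subset\mathbb{C}^n$ bounded, $\mathcal{O}(K)$ is the ring of germs of holomorphic functions on $K$: pairs $(f,\omega)$,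 $\omega$ an open neighborhood of $K$, $f$ holomorphic on $\omega$, modulo agreement on a smaller open neighborhood of $K$. A locally principal variety in an open set $\omega$ is a closed subset $V\subset\omega$ such that every $z\in\omega$ has a neighborhood $U(z)\subset\omega$ for which $U(z)\cap V$ is the zero set of a single nontrivial holomorphic function on $U(z)$. A germ of an analytic hypersurface in $K$ is an equivalence class of pairs $(V,\omega)$, where $\omega$ is an open neighborhood of $K$ and $V\subsetneq\omega$ is a locally principal variety in $\omega$, two pairs being equivalent if they agree on some open neighborhood of $K$; the set of these is denoted $\mathscr{V}(K)$. $V\in\mathscr{V}(\overline\Omega)$ is irreducible if it is not of the form $V_1\cup V_2$ with $V_1,V_2\in\mathscr{V}(\overline\Omega)$ distinct from $V$. $V$ is minimally defined if it is the zero set of some $\psi\in\mathcal{O}(\overline\Omega)$ such that whenever $U\subset\overline\Omega$ is relatively open and $g\in\mathcal{O}(U)$ vanishes on $U\cap V$, then $\psi|_U$ divides $g$ in $\mathcal{O}(U)$; such a $\psi$ is called a minimal defining function of $V$ (it is unique up to nonvanishing factors in $\mathcal{O}(\overline\Omega)$). Function spaces. $\mathcal{A}(\Omega,\nu)=\mathcal{O}(\Omega)\cap\mathcal{C}(\Omega\cup T)$. Let $T^*=T\setminus V$ and let $\psi\in\mathcal{O}(\overline\Omega)$ be a minimal defining function of $V$. For $k\in\mathbb{N}_0=\{0,1,2,\dots\}$, $\mathcal{A}_k(\Omega^*,\nu)$ is the set of functions $F:\Omega^*\cup T^*\to\mathbb{C}$ such that $F=(\psi^{-k}G)|_{\Omega^*\cup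 T^*}$ for some $G\in\mathcal{A}(\Omega,\nu)$ and $F|_{T^*}\in L^2(\nu)$; this does not depend on the choice of $\psi$. Elements of $\mathcal{A}_k(\Omega^*,\nu)$ are regarded as functions on $\Omega^*\cup T$ by extending them by zero to the $\nu$-null set $T\cap V$; admissibility of $\mathcal{A}_k(\Omega^*,\nu)$ is understood with $D=\Omega^*$ and this $\nu$ and $T$ (note $T\subset b\Omega\subset b\Omega^*$). *)

(* Defs.v *)
From HB Require Import structures.
From mathcomp Require Import all_boot all_order all_algebra.
From mathcomp Require Import complex.
From mathcomp Require Import all_classical all_reals all_analysis.

Set Implicit Arguments.
Unset Strict Implicit.
Unset Printing Implicit Defensive.

Import Order.TTheory GRing.Theory Num.Theory.
Import numFieldNormedType.Exports.

Local Open Scope classical_set_scope.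
Local Open Scope ring_scope.

(* R[i] packed as a numClosedFieldType, so that MathComp-Analysis finds its
   normed-module structure over itself; the norm of C R takes values in C R,
   [cmod] is the real-valued modulus. *)
Definition C (R : realType) : numClosedFieldType := R[i].
Definition cmod {R : realType} (z : C R) : R := Normc.normc (z : R[i]).

Notation Cn R n := ('rV[C R]_n).

Definition borel (X : ptopologicalType) := g_sigma_algebraType (@open X).

Definition boundary {X : topologicalType} (A : set X) : set X :=
  closure A `\` interior A.

(* Complex Frechet differentiability: the scalars of Cn R n are C R. *)
Definition holomorphic_on {R : realType} {n : nat}
    (omega : set (Cn R n)) (f : Cn R n -> C R) : Prop :=
  forall z, omega z -> differentiable f z.

Definition is_domain {R : realType} {n : nat} (Omega : set (Cn R n)) : Prop :=
  [/\ Omega !=set0, open Omega & connected Omega].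

Definition relatively_compact {R : realType} {n : nat}
    (Omega : set (Cn R n)) : Prop := compact (closure Omega).

(* A measure on the boundary of D is a Borel measure on C^n carried by it. *)
Definition carried_by {R : realType} {n : nat}
    (nu : {finite_measure set (borel (Cn R n)) -> \bar R})
    (A : set (Cn R n)) : Prop := nu (~` A) = 0%E.

Definition msupport {R : realType} {n : nat}
    (nu : {finite_measure set (borel (Cn R n)) -> \bar R}) : set (Cn R n) :=
  [set z | forall U : set (Cn R n), open U -> U z -> (0 < nu U)%E].

(* Functions are total; only the values of F on A matter. *)
Definition L2norm {R : realType} {n : nat}
    (nu : {finite_measure set (borel (Cn R n)) -> \bar R})
    (A : set (Cn R n)) (F : Cn R n -> C R) : \bar R :=
  Lnorm nu 2%:E (EFin \o ((cmod \o F) \_ A)).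

Definition in_L2 {R : realType} {n : nat}
    (nu : {finite_measure set (borel (Cn R n)) -> \bar R})
    (A : set (Cn R n)) (F : Cn R n -> C R) : Prop :=
  measurable_fun (A : set (borel (Cn R n))) (F : borel (Cn R n) -> borel (C R))
  /\ (L2norm nu A F < +oo)%E.

Definition L2cauchy {R : realType} {n : nat}
    (nu : {finite_measure set (borel (Cn R n)) -> \bar R})
    (A : set (Cn R n)) (F : nat -> Cn R n -> C R) : Prop :=
  forall e : R, 0 < e -> exists N : nat, forall m k : nat,
    (N <= m)%N -> (N <= k)%N -> (L2norm nu A (fun z => F m z - F k z)%R < e%:E)%E.

(* A family of functions on D `|` T is a set of total functions, of which only
   the values on D `|` T matter. *)
Definition weakly_admissible {R : realType} {n : nat} (D : set (Cn R n))
    (nu : {finite_measure set (borel (Cn R n)) -> \bar R})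
    (Fam : set (Cn R n -> C R)) : Prop :=
  (forall F, Fam F -> in_L2 nu (msupport nu) F) /\
  (forall K : set (Cn R n), compact K -> K `<=` D ->
     exists2 CK : R, 0 < CK & forall F, Fam F -> forall z, K z ->
       ((cmod (F z))%:E <= CK%:E * L2norm nu (msupport nu) F)%E).

Definition strongly_admissible {R : realType} {n : nat} (D : set (Cn R n))
    (nu : {finite_measure set (borel (Cn R n)) -> \bar R})
    (Fam : set (Cn R n -> C R)) : Prop :=
  weakly_admissible D nu Fam /\
  (forall F : nat -> Cn R n -> C R, (forall j, Fam (F j)) ->
     L2cauchy nu (msupport nu) F ->
     (forall K : set (Cn R n), compact K -> K `<=` D ->
        {uniform K, F @ \oo --> (fun=> 0 : C R)}) ->
     L2norm nu (msupport nu) (F j) @[j --> \oo] --> 0%E).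

(* Germs are handled through representatives; equality of germs is agreement
   on a neighborhood of K.  The values of a germ at the points of K do not
   depend on the representative. *)
Record hol_germ {R : realType} {n : nat} (K : set (Cn R n)) := HolGerm {
  hg_dom : set (Cn R n);
  hg_fun :> Cn R n -> C R;
  hg_open : open hg_dom;
  hg_sub : K `<=` hg_dom;
  hg_hol : holomorphic_on hg_dom hg_fun }.

Definition locally_principal {R : realType} {n : nat}
    (omega V : set (Cn R n)) : Prop :=
  (exists2 F : set (Cn R n), closed F & V = omega `&` F) /\
  (forall z, omega z -> exists (U : set (Cn R n)) (f : Cn R n -> C R),
     [/\ open U, U z, U `<=` omega, holomorphic_on U f &
         (exists2 w, U w & f w != 0) /\ U `&` V = [set w | U w /\ f w = 0]]).

Record hyp_germ {R : realType} {n : nat} (K : set (Cn R n)) := HypGerm {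
  vg_dom : set (Cn R n);
  vg_set :> set (Cn R n);
  vg_open : open vg_dom;
  vg_sub : K `<=` vg_dom;
  vg_proper : vg_set `<` vg_dom;
  vg_principal : locally_principal vg_dom vg_set }.

Definition hyp_germ_eq {R : realType} {n : nat} {K : set (Cn R n)}
    (V1 V2 : hyp_germ K) : Prop :=
  exists W : set (Cn R n),
    [/\ open W, K `<=` W, W `<=` vg_dom V1 `&` vg_dom V2 &
        W `&` V1 = W `&` V2].

Definition hyp_germ_eq_union {R : realType} {n : nat} {K : set (Cn R n)}
    (V V1 V2 : hyp_germ K) : Prop :=
  exists W : set (Cn R n),
    [/\ open W, K `<=` W, W `<=` vg_dom V `&` (vg_dom V1 `&` vg_dom V2) &
        W `&` V = W `&` (V1 `|` V2)].

Definition hyp_irreducible {R : realType} {n : nat} {K : set (Cn R n)}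
    (V : hyp_germ K) : Prop :=
  ~ exists V1 V2 : hyp_germ K,
      [/\ ~ hyp_germ_eq V1 V, ~ hyp_germ_eq V2 V & hyp_germ_eq_union V V1 V2].

Definition zero_set_germ {R : realType} {n : nat} {K : set (Cn R n)}
    (psi : hol_germ K) (V : hyp_germ K) : Prop :=
  exists W : set (Cn R n),
    [/\ open W, K `<=` W, W `<=` hg_dom psi `&` vg_dom V &
        W `&` V = [set z | W z /\ psi z = 0]].

(* For U `<=` K: the restriction of psi to U divides g in O(U). *)
Definition divides_on {R : realType} {n : nat} {K U : set (Cn R n)}
    (psi : hol_germ K) (g : hol_germ U) : Prop :=
  exists (h : hol_germ U) (W : set (Cn R n)),
    [/\ open W, U `<=` W,
        W `<=` hg_dom psi `&` (hg_dom g `&` hg_dom h) &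
        forall z, W z -> g z = psi z * h z].

(* g is required to vanish at the points of U `&` V, not on V near U. *)
Definition minimal_defining {R : realType} {n : nat} {K : set (Cn R n)}
    (V : hyp_germ K) (psi : hol_germ K) : Prop :=
  zero_set_germ psi V /\
  (forall U : set (Cn R n),
     (exists2 O : set (Cn R n), open O & U = K `&` O) ->
     forall g : hol_germ U,
       (forall z, (U `&` V) z -> g z = 0) -> divides_on psi g).

Definition minimally_defined {R : realType} {n : nat} {K : set (Cn R n)}
    (V : hyp_germ K) : Prop := exists psi : hol_germ K, minimal_defining V psi.

Definition A_space {R : realType} {n : nat} (Omega : set (Cn R n))
    (nu : {finite_measure set (borel (Cn R n)) -> \bar R}) :
    set (Cn R n -> C R) :=
  [set F | holomorphic_on Omega F /\
           {within Omega `|` msupport nu, continuous F}].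

(* The members live on (Omega `\` V) `|` T; the last clause is the extension by
   zero to T `&` V. *)
Definition Ak_space {R : realType} {n : nat} (Omega : set (Cn R n))
    (nu : {finite_measure set (borel (Cn R n)) -> \bar R})
    (V : set (Cn R n)) (psi : Cn R n -> C R) (k : nat) :
    set (Cn R n -> C R) :=
  [set F | [/\ exists2 G, A_space Omega nu G &
                 forall z, ((Omega `\` V) `|` (msupport nu `\` V)) z ->
                   F z = psi z ^- k * G z,
               in_L2 nu (msupport nu `\` V) F &
               forall z, (msupport nu `&` V) z -> F z = 0]].

(* Main.v *)
(* A member F = psi^-k G of A_k satisfies psi^(k+1) F = psi G on all of T,
   because both sides vanish on V; as psi is bounded on the closure of Omega and bounded away
   from 0 on compact subsets of Omega \ V, the weak estimate for psi G gives
   that for F.  If F_j is Cauchy in L2 and tends to 0 locally uniformly on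
   Omega \ V, then H_j = psi G_j is locally uniformly bounded on Omega and tends
   to 0 locally uniformly off V, so psi H_j tends to 0 locally uniformly on
   Omega: where |psi| is small by the bound on H_j, elsewhere by the convergence
   off V.  Strong admissibility then gives psi^(k+2) F_j -> 0 in L2, and the
   factor psi^(k+2) can be divided out in L2 by dominated convergence, since F_j
   vanishes where psi does. *)
Require Import Defs.
From HB Require Import structures.
From mathcomp Require Import all_boot all_order all_algebra.
From mathcomp Require Import complex.
From mathcomp Require Import all_classical all_reals all_analysis.
From mathcomp Require Import measurable_realfun ring lra.
Import Order.TTheory GRing.Theory Num.Theory.
Import numFieldNormedType.Exports.
Local Open Scope classical_set_scope.
Local Open Scope ring_scope.

(** * The real-valued modulus and its continuity *)

Lemma cmodE {R : realType} (z : C R) : `|z| = (cmod z)%:C%C :> C R.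
Proof. by []. Qed.

Lemma cmod0 (R : realType) : cmod (0 : C R) = 0.
Proof. exact: Normc.normc0. Qed.

Lemma cmod_ge0 {R : realType} (z : C R) : 0 <= cmod z.
Proof. by rewrite -lecR -cmodE; exact: normr_ge0. Qed.

Lemma cmodM {R : realType} (z w : C R) : cmod (z * w) = cmod z * cmod w.
Proof. exact: Normc.normcM. Qed.

Lemma cmodX {R : realType} (z : C R) (k : nat) : cmod (z ^+ k) = cmod z ^+ k.
Proof.
elim: k => [|k IH]; first exact: Normc.normc1.
by rewrite !exprS cmodM IH.
Qed.

Lemma cmodD {R : realType} (z w : C R) : cmod (z + w) <= cmod z + cmod w.
Proof. exact: le_normcD. Qed.

Lemma cmodBC {R : realType} (z w : C R) : cmod (z - w) = cmod (w - z).
Proof. by rewrite -[RHS]normcN opprB. Qed.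

Lemma cmod_dist {R : realType} (z w : C R) :
  `|cmod z - cmod w| <= cmod (z - w).
Proof.
rewrite ler_norml; apply/andP; split.
  rewrite lerNl opprB lerBlDl cmodBC.
  by have := cmodD z (w - z); rewrite addrC subrK addrC.
rewrite lerBlDl; by have := cmodD w (z - w); rewrite addrC subrK.
Qed.

(** Comparable complex numbers have equal imaginary parts, so a positive radius in [C R] is a
    positive real. This lets real epsilons replace the complex radii of the topology of [C R]. *)
Lemma gt0_real_complex {R : realType} {e : C R} :
  0 < e -> exists2 r : R, 0 < r & e = r%:C%C.
Proof.
case: e => a b; rewrite ltcE /= => /andP[/eqP b0 a0]; exists a => //.
by rewrite b0.
Qed.

(** Serves the modulus, [Re] and [Im], all 1-Lipschitz for [cmod]; the real epsilon, read as a
    complex radius, gives the required ball. *)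
Lemma lipschitz_cmod_continuous {R : realType} {g : C R -> R} :
  (forall z w, `|g z - g w| <= cmod (z - w)) -> continuous g.
Proof.
move=> hg z; apply/(@cvgrPdist_lt _ _ _ _ (nbhs_filter z)) => e e0.
have : nbhs z [set w : C R | `|z - w| < (e%:C%C : C R)].
  apply/nbhs_ballP; exists (e%:C%C : C R); first by rewrite /= -ltcR in e0 *.
  by move=> w; rewrite -ball_normE.
apply: filterS => w /=; rewrite cmodE ltcR; exact: le_lt_trans.
Qed.

Lemma continuous_cmod (R : realType) : continuous (@cmod R).
Proof. apply: lipschitz_cmod_continuous; exact: cmod_dist. Qed.

Lemma continuous_Re (R : realType) : continuous (fun z : C R => complex.Re z : R).
Proof.
apply: lipschitz_cmod_continuous => -[a b] [c d].
rewrite /cmod/Normc.normc /= -{1}sqrtr_sqr ler_sqrt.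
  by rewrite lerDl sqr_ge0.
by rewrite addr_ge0 ?sqr_ge0.
Qed.

Lemma continuous_Im (R : realType) : continuous (fun z : C R => complex.Im z : R).
Proof.
apply: lipschitz_cmod_continuous => -[a b] [c d].
rewrite /cmod/Normc.normc /= -{1}sqrtr_sqr ler_sqrt.
  by rewrite lerDr sqr_ge0.
by rewrite addr_ge0 ?sqr_ge0.
Qed.

(** * Uniform convergence and bounds on compact sets in terms of the modulus *)

Lemma uniform_cvg0P {R : realType} {X : choiceType} (K : set X)
    (F : nat -> X -> C R) :
  {uniform K, F @ \oo --> (fun=> 0 : C R)} <->
  forall e : R, 0 < e -> exists N : nat, forall j, (N <= j)%N ->
    forall z, K z -> cmod (F j z) < e.
Proof.
split=> [Fu e e0|Fu P /uniform_nbhs [E [entE EP]]].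
  have : nbhs ((fun=> 0) : {uniform` K -> C R})
      [set h : X -> C R | forall z, K z -> cmod (h z) < e].
    apply/uniform_nbhs; exists [set xy : C R * C R | ball xy.1 (e%:C%C : C R) xy.2]; split.
      by apply: entourage_ball (PosNum _); rewrite -ltcR in e0.
    move=> h hE z Kz; have := hE z Kz.
    by rewrite /= -ball_normE /= sub0r normrN cmodE ltcR.
  by move=> /Fu [N _ NF]; exists N => j Nj z Kz; exact: (NF j Nj).
have [e e0 eE] : exists2 e : C R, 0 < e &
    [set xy : C R * C R | ball xy.1 e xy.2] `<=` E.
  by move: entE; rewrite -entourage_ballE => -[e /= e0 eE]; exists e.
have [r r0 er] := gt0_real_complex e0.
have [N NF] := Fu r r0.
exists N => // j /= Nj; apply: EP => z Kz; apply: eE.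
by rewrite /= -ball_normE /= sub0r normrN cmodE er ltcR; exact: NF.
Qed.

Lemma compact_cmod_bounded {R : realType} {X : topologicalType} {K : set X}
    {f : X -> C R} :
  compact K -> {within K, continuous f} ->
  exists2 M : R, 0 < M & forall z, K z -> cmod (f z) <= M.
Proof.
move=> cK cf.
have : compact ((@cmod R \o f) @` K).
  apply: continuous_compact => // z.
  apply: (@continuous_comp (subspace K) (C R) R f (@cmod R)); first exact: cf.
  exact: continuous_cmod.
move=> /(@compact_bounded R R^o)[M [_ MK]].
exists (`|M| + 1); first by rewrite ltr_wpDl.
move=> z Kz; apply: le_trans (ler_norm _) _.
apply: (MK _ _ (cmod (f z))); last by exists z.
by rewrite (le_lt_trans (ler_norm _))// ltrDl.
Qed.

(** * Square-integral norms on a measure space *)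

Lemma Lnorm2E {d} {T : measurableType d} {R : realType}
    (mu : {measure set T -> \bar R}) (u : T -> R) :
  ('N[mu]_2%:E [EFin \o u] = (\int[mu]_x ((u x) ^+ 2)%:E) `^ 2^-1)%E.
Proof.
rewrite unlock /Lnorm; congr (_ `^ _)%E; apply: eq_integral => x _ /=.
by rewrite powR_mulrn// real_normK ?num_real.
Qed.

(** Written as the square root of [c ^+ 2], the constant moves under the integral; monotonicity of
    the integral and of the square root then suffices. *)
Lemma le_Lnorm2 {d} {T : measurableType d} {R : realType}
    (mu : {measure set T -> \bar R}) (u v : T -> R) (c : R) :
  measurable_fun setT u -> measurable_fun setT v -> 0 <= c ->
  (forall x, `|u x| <= c * `|v x|) ->
  ('N[mu]_2%:E [EFin \o u] <= c%:E * 'N[mu]_2%:E [EFin \o v])%E.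
Proof.
move=> mu_ mv c0 uv; rewrite !Lnorm2E.
have -> : (c%:E = (c ^+ 2)%:E `^ 2^-1)%E.
  by rewrite poweR_EFin powR12_sqrt ?sqr_ge0// sqrtr_sqr ger0_norm.
have v0 : (0 <= \int[mu]_x ((v x) ^+ 2)%:E)%E.
  by apply: integral_ge0 => x _; rewrite lee_fin sqr_ge0.
rewrite -poweRM ?lee_fin ?sqr_ge0//.
apply: gt0_ler_poweR; rewrite ?invr_ge0 ?nnegrE//.
- rewrite in_itv/= leey andbT; apply: integral_ge0 => x _.
  by rewrite lee_fin sqr_ge0.
- by rewrite in_itv/= leey andbT mule_ge0// lee_fin sqr_ge0.
have mv2 : measurable_fun setT (EFin \o (fun x => (v x) ^+ 2)%R).
  by apply/measurable_EFinP; exact: measurable_funX.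
rewrite -ge0_integralZl_EFin ?sqr_ge0//; last first.
  by move=> x _; rewrite lee_fin sqr_ge0.
apply: ge0_le_integral => //.
- by move=> x _; rewrite lee_fin sqr_ge0.
- by apply/measurable_EFinP; exact: measurable_funX.
- exact: measurable_funeM.
- move=> x _; rewrite -EFinM lee_fin -exprMn -[leLHS]real_normK ?num_real//.
  rewrite -[leRHS]real_normK ?num_real//.
  by rewrite lerXn2r ?nnegrE// normrM (ger0_norm c0).
Qed.

(** Dominated convergence: the squares of [w m * u] are eventually zero at each point and are
    dominated by the integrable function [u ^+ 2]. *)
Lemma Lnorm2_vanishing_weight {d} {T : measurableType d} {R : realType}
    {mu : {measure set T -> \bar R}} {u : T -> R} {w : nat -> T -> R} {e : R} :
  measurable_fun setT u -> (forall m, measurable_fun setT (w m)) ->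
  (forall m x, 0 <= w m x <= 1) ->
  (forall x, \forall m \near \oo, w m x * u x = 0) ->
  ('N[mu]_2%:E [EFin \o u] < +oo)%E -> 0 < e ->
  exists m, ('N[mu]_2%:E [EFin \o (w m \* u)%R] < e%:E)%E.
Proof.
move=> mu_ mw w01 wu uoo e0.
have mf m : measurable_fun setT (EFin \o (fun x => (w m x * u x) ^+ 2)%R).
  by apply/measurable_EFinP/measurable_funX/measurable_funM.
have iu : mu.-integrable setT (EFin \o (fun x => (u x) ^+ 2)%R).
  apply/integrableP; split; first exact/measurable_EFinP/measurable_funX.
  move: uoo; rewrite Lnorm2E => /lty_poweRy h.
  under eq_integral do rewrite abse_EFin ger0_norm ?sqr_ge0//.
  by apply: h; rewrite invr_eq0.
pose f m := (EFin \o (fun x => (w m x * u x) ^+ 2))%R.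
have f0 : {ae mu, forall x, setT x -> f ^~ x @ \oo --> (cst 0%E : T -> \bar R) x}.
  apply: aeW => x _; apply: cvg_near_cst.
  by apply: filterS (wu x) => m wu0; rewrite /f /= wu0 expr0n.
have fu : {ae mu, forall x n, setT x ->
    (`|f n x| <= (EFin \o (fun x => (u x) ^+ 2)%R) x)%E}.
  apply: aeW => x m _; rewrite /f /= lee_fin ger0_norm ?sqr_ge0// exprMn.
  have /andP[w0 w1] := w01 m x.
  by rewrite ler_piMl ?sqr_ge0// exprn_ile1.
have [_ _] := dominated_convergence measurableT mf (measurable_cst _) f0 iu fu.
rewrite integral0 => h.
(* The half leaves room for strictness: monotonicity of the square root is used in its weak form and
   yields a norm at most [e / 2]. *)
have /h : nbhs (0%E : \bar R) [set y | (y < ((e / 2) ^+ 2)%:E)%E].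
  by apply: open_ereal_lt'; rewrite lte_fin exprn_gt0// divr_gt0.
move=> [m _ /(_ m (leqnn m))/= hm]; exists m.
rewrite Lnorm2E.
have e2 : 0 <= e / 2 by rewrite divr_ge0// ltW.
apply: (@le_lt_trans _ _ (e / 2)%:E); last by rewrite lte_fin gtr_pMr// invf_lt1// ltr1n.
have -> : ((e / 2)%:E = ((e / 2) ^+ 2)%:E `^ 2^-1)%E.
  by rewrite poweR_EFin powR12_sqrt ?sqr_ge0// sqrtr_sqr ger0_norm.
apply: gt0_ler_poweR; rewrite ?invr_ge0 ?nnegrE//.
- rewrite in_itv/= leey andbT; apply: integral_ge0 => x _.
  by rewrite lee_fin sqr_ge0.
- by rewrite in_itv/= leey andbT lee_fin sqr_ge0.
- exact: ltW.
Qed.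

(** Translates convergence in the extended reals, where norms live, into epsilons; the bound for
    epsilon 1 makes the terms eventually finite, so that real convergence applies. *)
Lemma ereal_cvg0P {R : realType} {f : nat -> \bar R} :
  (forall j, (0 <= f j)%E) ->
  (f j @[j --> \oo] --> 0%E) <->
  (forall e : R, 0 < e -> exists N : nat, forall j, (N <= j)%N -> (f j < e%:E)%E).
Proof.
move=> f0; split=> [h e e0|h].
  have /h : nbhs (0%E : \bar R) [set y | (y < e%:E)%E] by exact: open_ereal_lt'.
  by move=> [N _ fN]; exists N => j Nj; exact: fN.
apply/fine_cvgP; split.
  have [N fN] := h 1 ltr01; exists N => // j Nj.
  by rewrite ge0_fin_numE// (lt_trans (fN j Nj))// ltry.
apply/cvgrPdist_lt => e e0; have [N fN] := h e e0.
exists N => // j Nj; rewrite /= sub0r normrN ger0_norm ?fine_ge0//.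
by rewrite -lte_fin fineK ?fN// ge0_fin_numE// (lt_trans (fN j Nj))// ltry.
Qed.

(** * Borel measurability *)

Lemma borel_open_measurable {X : ptopologicalType} {A : set X} :
  open A -> measurable (A : set (borel X)).
Proof. exact: sub_sigma_algebra. Qed.

Lemma borel_closed_measurable {X : ptopologicalType} {A : set X} :
  closed A -> measurable (A : set (borel X)).
Proof.
move=> cA; rewrite -[A]setCK; apply: measurableC; apply: borel_open_measurable.
exact: closed_openC.
Qed.

Lemma within_continuous_measurable {X : ptopologicalType} {R : realType}
    {A : set X} {f : X -> R} :
  measurable (A : set (borel X)) -> {within A, continuous f} ->
  measurable_fun (A : set (borel X)) (f : borel X -> R).
Proof.
move=> mA /continuousP cf; apply: (measurability _ (RGenOpens.measurableE R)).
move=> _ [_ [a [b ->] <-]].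
have oab : open (`]a, b[%classic : set R) by exact: interval_open.
have /open_subspaceP[V oV VA] := cf _ oab.
rewrite setIC -[X in measurable X]VA; apply: measurableI => //.
exact: borel_open_measurable.
Qed.

Lemma borel_measurable_comp {X Y : ptopologicalType} {R : realType} {A : set X}
    {F : X -> Y} {g : Y -> R} :
  measurable_fun (A : set (borel X)) (F : borel X -> borel Y) ->
  continuous g -> measurable_fun (A : set (borel X)) (g \o F : borel X -> R).
Proof.
move=> mF cg; have mg : measurable_fun (setT : set (borel Y)) (g : borel Y -> R).
  apply: within_continuous_measurable; first exact: measurableT.
  exact: continuous_subspaceT.
exact: measurableT_comp mg mF.
Qed.

(** * Norm estimates over a measurable set, and division by a factor in the limit *)

Section L2norm.
Context {R : realType} {n : nat}.
Variables (nu : {finite_measure set (borel (Cn R n)) -> \bar R}).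
Context {A : set (Cn R n)}.
Hypothesis mA : measurable (A : set (borel (Cn R n))).
Implicit Types F G p : Cn R n -> C R.
Local Notation mfun F :=
  (measurable_fun (A : set (borel (Cn R n))) (F : borel (Cn R n) -> borel (C R))).
Local Notation mcmod F :=
  (measurable_fun (A : set (borel (Cn R n))) (cmod \o F : borel (Cn R n) -> R)).

Lemma measurable_cmod F : mfun F -> mcmod F.
Proof. by move=> mF; apply: borel_measurable_comp mF (@continuous_cmod R). Qed.

(** Real and imaginary parts reduce the measurability of a difference to that of real functions. *)
Lemma measurable_cmodB F G : mfun F -> mfun G -> mcmod (fun z => F z - G z).
Proof.
move=> mF mG.
have mr := borel_measurable_comp mF (@continuous_Re R).
have mi := borel_measurable_comp mF (@continuous_Im R).
have mr' := borel_measurable_comp mG (@continuous_Re R).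
have mi' := borel_measurable_comp mG (@continuous_Im R).
have -> : cmod \o (fun z => F z - G z) = (Num.sqrt : R -> R) \o
    (fun z => (complex.Re (F z) - complex.Re (G z)) ^+ 2 +
              (complex.Im (F z) - complex.Im (G z)) ^+ 2).
  by apply/funext => z /=; case: (F z) => a b; case: (G z) => c d.
have ms : measurable_fun setT (Num.sqrt : R -> R).
  apply: continuous_measurable_fun; exact: sqrt_continuous.
apply: (measurableT_comp ms).
by apply: measurable_funD; apply: measurable_funX; apply: measurable_funB.
Qed.

Lemma measurable_cmodM F G : mcmod F -> mcmod G -> mcmod (fun z => F z * G z).
Proof.
move=> mF mG; have -> : cmod \o (fun z => F z * G z) = (cmod \o F) \* (cmod \o G).
  by apply/funext => z /=; rewrite cmodM.
exact: measurable_funM.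
Qed.

Lemma measurable_restr_cmod F : mcmod F ->
  measurable_fun setT ((cmod \o F) \_ A : borel (Cn R n) -> R).
Proof. by move=> mF; exact: (measurable_restrictT _ mA).1 mF. Qed.

Lemma le_L2norm F G (c : R) : mcmod F -> mcmod G -> 0 <= c ->
  (forall z, A z -> cmod (F z) <= c * cmod (G z)) ->
  (L2norm nu A F <= c%:E * L2norm nu A G)%E.
Proof.
move=> mF mG c0 FG; apply: le_Lnorm2 => //; try exact: measurable_restr_cmod.
move=> x; rewrite /patch; case: ifPn => [|_]; last by rewrite normr0 mulr0.
by move=> /set_mem Ax; rewrite !ger0_norm ?cmod_ge0//; exact: FG.
Qed.

Lemma L2norm_triangle F G : mfun F -> mfun G ->
  (L2norm nu A F <= L2norm nu A (fun z => F z - G z)%R + L2norm nu A G)%E.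
Proof.
move=> mF mG.
have mf := measurable_restr_cmod _ (measurable_cmod _ mF).
have mg := measurable_restr_cmod _ (measurable_cmod _ mG).
have md := measurable_restr_cmod _ (measurable_cmodB _ _ mF mG).
have l12 : 1 <= 2 :> R by rewrite ler1n.
apply: le_trans (minkowski_EFin nu (p := 2) md mg l12).
rewrite -[leRHS]mul1e; apply: le_Lnorm2 => //; first exact: measurable_funD.
move=> x; rewrite mul1r /= /patch; case: ifPn => _; last by rewrite addr0.
rewrite !ger0_norm ?addr_ge0 ?cmod_ge0//.
by have := cmodD (F x - G x) (G x); rewrite subrK.
Qed.

(** With the cutoff [w = max(0, 1 - m|p|)], split [|F_j|] into [w|F_j| + (1 - w)|F_j|]. The first
    term is at most [|F_j - F_N1| + w|F_N1|] because [w <= 1], the second at most [m|p F_j|]. The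
    Cauchy property controls the difference, a large [m] the weighted fixed function, and then a
    large [j] the last term. *)
Lemma L2norm_cvg0_divide (p : Cn R n -> C R) (F : nat -> Cn R n -> C R) :
  mcmod p -> (forall j, in_L2 nu A (F j)) -> L2cauchy nu A F ->
  (forall z, A z -> p z = 0 -> forall j, F j z = 0) ->
  (forall e : R, 0 < e -> exists N : nat, forall j, (N <= j)%N ->
     (L2norm nu A (fun z => p z * F j z)%R < e%:E)%E) ->
  forall e : R, 0 < e -> exists N : nat, forall j, (N <= j)%N ->
    (L2norm nu A (F j) < e%:E)%E.
Proof.
move=> mp F2 Fc pF pF0 e e0.
have e3 : 0 < e / 3 by rewrite divr_gt0.
have mF j : mfun (F j) by case: (F2 j).
have [N1 FN1] := Fc _ e3.
pose u := (cmod \o F N1) \_ A; pose q := (cmod \o p) \_ A.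
(* The cutoff is 1 where [q] vanishes and becomes 0 once [m] reaches [1 / q x]. *)
pose w (m : nat) x : R := Num.max 0 (1 - m%:R * q x).
have mu_ : measurable_fun setT (u : borel (Cn R n) -> R).
  by apply: measurable_restr_cmod; exact: measurable_cmod.
have mq : measurable_fun setT (q : borel (Cn R n) -> R).
  exact: measurable_restr_cmod.
have q0 x : 0 <= q x by rewrite /q /patch; case: ifP => // _; exact: cmod_ge0.
have mw m : measurable_fun setT (w m : borel (Cn R n) -> R).
  apply: measurable_maxr => //; apply: measurable_funB => //.
  exact: measurable_funM.
have w01 m x : 0 <= w m x <= 1.
  by rewrite /w le_max lexx /= ge_max ler01 gerBl mulr_ge0.
have wu x : \forall m \near \oo, w m x * u x = 0.
  have [qx0|qx] := eqVneq (q x) 0.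
    (* If [q x = 0], then either [x] lies outside [A] or [p x = 0]; in both cases [u x = 0], so the
       weight is irrelevant. *)
    apply: nearW => m; suff -> : u x = 0 by rewrite mulr0.
    move: qx0; rewrite /q /u /patch; case: ifPn => // /set_mem Ax /= px.
    by rewrite (pF x Ax) ?cmod0//; exact: Normc.eq0_normc.
  have qx0 : 0 < q x by rewrite lt_def qx q0.
  exists (Num.truncn (q x)^-1).+1 => // m /= hm.
  suff -> : w m x = 0 by rewrite mul0r.
  apply/max_idPl; rewrite subr_le0 -ler_pdivrMr// div1r.
  by apply: (le_trans (ltW (truncnS_gt _))); rewrite ler_nat.
have uoo : ('N[nu]_2%:E [EFin \o u] < +oo)%E by case: (F2 N1).
have [m wm] := Lnorm2_vanishing_weight mu_ mw w01 wu uoo e3.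
(* The index [m] is now fixed and may be 0; its successor keeps the denominator positive and still
   bounds [m] from above. *)
have em : 0 < e / 3 / m.+1%:R by rewrite divr_gt0.
have [N2 FN2] := pF0 _ em.
exists (maxn N1 N2) => j; rewrite geq_max => /andP[Nj1 Nj2].
pose d := (cmod \o (fun z => F j z - F N1 z)) \_ A.
pose h := (cmod \o (fun z => p z * F j z)) \_ A.
have md : measurable_fun setT (d : borel (Cn R n) -> R).
  by apply: measurable_restr_cmod; exact: measurable_cmodB.
have mh : measurable_fun setT (h : borel (Cn R n) -> R).
  by apply: measurable_restr_cmod; apply: measurable_cmodM => //; exact: measurable_cmod.
have mmh : measurable_fun setT ((fun x => m.+1%:R * h x) : borel (Cn R n) -> R).
  exact: measurable_funM.
have mwu : measurable_fun setT ((w m \* u)%R : borel (Cn R n) -> R).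
  exact: measurable_funM.
have : (L2norm nu A (F j) <= 1%:E * 'N[nu]_2%:E [EFin \o
    (d \+ ((w m \* u) \+ (fun x => m.+1%:R * h x)))%R])%E.
  apply: le_Lnorm2 => //.
  - by apply: measurable_restr_cmod; exact: measurable_cmod.
  - by apply: measurable_funD => //; exact: measurable_funD.
  move=> x; rewrite mul1r; apply: le_trans (ler_norm _).
  have /andP[w0 w1] := w01 m x.
  have : 1 - m%:R * q x <= w m x by rewrite /w le_max lexx orbT.
  rewrite /= /d /u /h /q /patch; case: ifPn => [Ax|_]; last first.
    by rewrite normr0 !mulr0 !addr0.
  rewrite /= (ger0_norm (cmod_ge0 _)) cmodM => w1p.
  have Fd : cmod (F j x) <= cmod (F j x - F N1 x) + cmod (F N1 x).
    by have := cmodD (F j x - F N1 x) (F N1 x); rewrite subrK.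
  have d0 := cmod_ge0 (F j x - F N1 x); have F0 := cmod_ge0 (F j x).
  have p0 := cmod_ge0 (p x).
  have pF1 : 0 <= cmod (p x) * cmod (F j x) by rewrite mulr_ge0.
  rewrite -natr1.
  have := ler_wpM2r F0 w1p.
  have := ler_wpM2l w0 Fd.
  have := ler_wpM2r d0 w1.
  rewrite !mulrDl !mulrDr mulNr !mul1r -!mulrA.
  by lra.
rewrite mul1e => /le_lt_trans; apply.
have e3E : e = e / 3 + (e / 3 + e / 3) by field.
rewrite [in ltRHS]e3E !EFinD.
apply: (@le_lt_trans _ _ ('N[nu]_2%:E[EFin \o d] + ('N[nu]_2%:E[EFin \o (w m \* u)%R]
    + 'N[nu]_2%:E[EFin \o (fun x => m.+1%:R * h x)%R]))%E).
  have l12 : 1 <= 2 :> R by rewrite ler1n.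
  apply: le_trans (minkowski_EFin nu (p := 2) md (measurable_funD mwu mmh) l12) _.
  apply: leeD2l; exact: (minkowski_EFin nu mwu mmh l12).
apply: lteD; first exact: FN1.
apply: lteD => //.
apply: (@le_lt_trans _ _ (m.+1%:R%:E * 'N[nu]_2%:E[EFin \o h])%E).
  apply: le_Lnorm2 => // x.
  by rewrite normrM (ger0_norm (ler0n _ _)).
have := FN2 j Nj2.
rewrite -(@lte_pmul2l _ m.+1%:R%:E) ?lte_fin ?ltr0n//.
by rewrite -EFinM mulrC divfK ?pnatr_eq0.
Qed.

End L2norm.

(** * The support of [nu], extension by zero, and clearing powers of [psi] *)

Section admissible_division.
Context {R : realType} {n : nat}.
Variables (Omega V : set (Cn R n)) (psi : Cn R n -> C R).
Variable nu : {finite_measure set (borel (Cn R n)) -> \bar R}.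
Hypothesis oOmega : open Omega.
Hypothesis cOmega : compact (closure Omega).
Hypothesis nuOmega : carried_by nu (boundary Omega).
Hypothesis dpsi : forall z, closure Omega z -> differentiable psi z.
Hypothesis psi0 : forall z, closure Omega z -> V z <-> psi z = 0.
Local Notation T := (msupport nu).

(** A point outside the support has an open null neighborhood, and no point of that neighborhood can
    belong to the support. *)
Lemma msupport_closed : closed T.
Proof.
rewrite -[T]setCK; apply: open_closedC; rewrite openE => z /= Tz.
have [U [oU Uz U0]] : exists U, [/\ open U, U z & ~ (0 < nu U)%E].
  by apply: contrapT => h; apply: Tz => U oU Uz; apply: contrapT => ?; apply: h; exists U.
apply: filterS (open_nbhs_nbhs (conj oU Uz)) => w Uw Tw.
exact/U0/Tw.
Qed.

(** The complement of the boundary is open and null, so it contains no point of the support. *)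
Lemma msupport_sub_closure : T `<=` closure Omega.
Proof.
suff Tb : T `<=` boundary Omega by move=> z /Tb[].
move=> z Tz; apply: contrapT => bz.
suff /Tz/(_ bz) : open (~` boundary Omega) by rewrite nuOmega ltxx.
apply: closed_openC; apply: closedI; first exact: closed_closure.
exact/open_closedC/open_interior.
Qed.

Lemma measurable_msupport : measurable (T : set (borel (Cn R n))).
Proof. exact: borel_closed_measurable msupport_closed. Qed.

Lemma within_continuous_psi A : A `<=` closure Omega -> {within A, continuous psi}.
Proof.
move=> AO; apply/subspace_continuousP => z Az.
apply: cvg_within_filter.
exact/differentiable_continuous/dpsi/AO.
Qed.

Lemma psi_bounded : exists2 M : R, 0 < M &
  forall z, closure Omega z -> cmod (psi z) <= M.
Proof. by apply: compact_cmod_bounded => //; exact: within_continuous_psi. Qed.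

Lemma measurable_cmod_psiX (i : nat) : measurable_fun
  (T : set (borel (Cn R n))) (cmod \o (fun z => psi z ^+ i) : borel (Cn R n) -> R).
Proof.
have mpsi : measurable_fun (T : set (borel (Cn R n)))
    (cmod \o psi : borel (Cn R n) -> R).
  apply: within_continuous_measurable; first exact: measurable_msupport.
  move=> z.
  apply: (@continuous_comp (subspace T) (C R) R psi (@cmod R)).
    exact/within_continuous_psi/msupport_sub_closure.
  exact: continuous_cmod.
have -> : cmod \o (fun z => psi z ^+ i) = (fun z => cmod (psi z) ^+ i).
  by apply/funext => z /=; rewrite cmodX.
exact: measurable_funX.
Qed.

(** Inside [T] the hypersurface is the zero set of [cmod \o psi], which is measurable on [T];
    exponent 1 brings it under the lemma on powers. *)
Lemma measurable_msupportI : measurable (T `&` V : set (borel (Cn R n))).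
Proof.
have -> : T `&` V = T `&` (cmod \o (fun z => psi z ^+ 1)) @^-1` [set 0].
  apply/seteqP; split=> z [Tz]; have cz := msupport_sub_closure _ Tz.
    by move=> /(psi0 _ cz) pz; split=> //=; rewrite expr1 pz cmod0.
  by rewrite /= expr1 => /Normc.eq0_normc pz; split=> //; exact/psi0.
apply: measurable_cmod_psiX; first exact: measurable_msupport.
exact: measurable_set1.
Qed.

(** Measurability is glued from the two measurable pieces of [T]. The norms agree because the two
    restricted moduli are the same function. *)
Lemma in_L2_extend0 F : in_L2 nu (T `\` V) F ->
  (forall z, (T `&` V) z -> F z = 0) -> in_L2 nu T F.
Proof.
move=> [mF nF] F0.
have TVE : T `\` V = T `\` (T `&` V).
  by apply/seteqP; split=> z [Tz h]; split=> //; [case|move=> Vz; apply: h].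
split.
  have TE : T = (T `\` V) `|` (T `&` V) by rewrite setUC setUIDK.
  rewrite [X in measurable_fun X]TE; apply/measurable_funU.
  - rewrite TVE; apply: measurableD; first exact: measurable_msupport.
    exact: measurable_msupportI.
  - exact: measurable_msupportI.
  split=> //; apply: (eq_measurable_fun
    (cst (0 : C R) : borel (Cn R n) -> borel (C R))); last exact: measurable_cst.
  by move=> z /set_mem TVz; rewrite F0.
suff <- : L2norm nu (T `\` V) F = L2norm nu T F by [].
congr (Lnorm nu 2%:E (EFin \o _)); apply/funext => z; rewrite /patch /=.
have [/set_mem Tz|nTz] := boolP (z \in T); last first.
  by rewrite memNset// => -[Tz _]; move: nTz; rewrite mem_set.
have [Vz|nVz] := pselect (V z); last by rewrite mem_set.
by rewrite memNset ?F0 ?cmod0//; case.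
Qed.

Lemma A_space_psiM G : A_space Omega nu G ->
  A_space Omega nu (fun z => psi z * G z).
Proof.
move=> [hG cG]; split=> [z Oz|z].
  by apply: differentiableM; [exact/dpsi/subset_closure|exact: hG].
apply: (@cvgM _ (subspace (Omega `|` T))); last exact: cG.
apply: within_continuous_psi => w [/subset_closure//|].
exact: msupport_sub_closure.
Qed.

(** On [T] inside [V], [G] may be nonzero while the extended [F] is 0, so [psi ^+ k * F] may differ
    from [G] there. The additional factor [psi] makes both sides vanish on [V]. *)
Lemma A_space_clear_denominator {k F} : Ak_space Omega nu V psi k F ->
  exists2 H, A_space Omega nu H &
    forall z, ((Omega `\` V) `|` T) z -> H z = psi z ^+ k.+1 * F z.
Proof.
move=> [[G AG FG] _ F0]; exists (fun z => psi z * G z); first exact: A_space_psiM.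
move=> z OVT; have cz : closure Omega z.
  case: OVT => [[/subset_closure//]|]; exact: msupport_sub_closure.
have [Vz|nVz] := pselect (V z).
  by rewrite ((psi0 _ cz).1 Vz) exprS !mul0r.
rewrite FG; last by case: OVT => [|Tz]; [left|right].
have pz : psi z != 0 by apply/eqP => /(psi0 _ cz).
by rewrite exprS -mulrA [_ ^+ _ * _]mulrA divff ?mul1r// expf_neq0.
Qed.

Lemma Ak_space_in_L2 {k F} : Ak_space Omega nu V psi k F -> in_L2 nu T F.
Proof. by move=> [_ F2 F0]; exact: in_L2_extend0. Qed.

(** * Weak and strong admissibility of the quotient families *)

Lemma Ak_weakly_admissible k : weakly_admissible Omega nu (A_space Omega nu) ->
  weakly_admissible (Omega `\` V) nu (Ak_space Omega nu V psi k).
Proof.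
move=> [A2 AK]; split=> [F AkF|K cK KOV]; first exact: Ak_space_in_L2 AkF.
have KO : K `<=` Omega by move=> z /KOV[].
have [CK CK0 CKA] := AK K cK KO.
have [M M0 psiM] := psi_bounded.
have psiN0 z : K z -> psi z != 0.
  by move=> /KOV[Oz nVz]; apply/eqP => /(psi0 _ (subset_closure Oz)).
have [B B0 psiVB] : exists2 B : R, 0 < B & forall z, K z -> cmod (psi z)^-1 <= B.
  apply: compact_cmod_bounded => //; apply/subspace_continuousP => z Kz.
  apply: cvg_within_filter; apply: cvgV; first exact: psiN0.
  exact/differentiable_continuous/dpsi/subset_closure/KO.
(* Three factors: [B ^+ k.+1] for dividing by [psi ^+ k.+1] on [K], [CK] from the weak estimate for
   [H], and [M ^+ k.+1] for bounding the norm of [H] by that of [F]. *)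
exists (B ^+ k.+1 * CK * M ^+ k.+1); first by rewrite !mulr_gt0 ?exprn_gt0.
move=> F AkF z Kz.
have [H AH HF] := A_space_clear_denominator AkF.
have F2 := Ak_space_in_L2 AkF; have H2 := A2 _ AH.
have HFL : (L2norm nu T H <= (M ^+ k.+1)%:E * L2norm nu T F)%E.
  apply: le_L2norm; rewrite ?exprn_ge0 ?ltW//.
  - exact: measurable_msupport.
  - by apply: measurable_cmod; case: H2.
  - by apply: measurable_cmod; case: F2.
  move=> w Tw; rewrite HF; last by right.
  rewrite cmodM cmodX ler_wpM2r ?cmod_ge0// lerXn2r ?nnegrE ?cmod_ge0 ?(ltW M0)//.
  exact/psiM/msupport_sub_closure.
have FH : F z = (psi z)^-1 ^+ k.+1 * H z.
  by rewrite HF ?mulrA ?exprVn ?mulVf ?mul1r ?expf_neq0 ?psiN0//; left; exact: KOV.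
rewrite FH cmodM cmodX EFinM [(_ * CK * _)%:E]EFinM [(_ * CK)%:E]EFinM -!muleA.
apply: lee_pmul; rewrite ?lee_fin ?exprn_ge0 ?cmod_ge0//.
  by rewrite lerXn2r ?nnegrE ?cmod_ge0 ?(ltW B0)// psiVB.
apply: le_trans (CKA _ AH _ Kz) _.
by rewrite lee_pmul2l ?lte_fin.
Qed.

Lemma Ak_strongly_admissible k :
  strongly_admissible Omega nu (A_space Omega nu) ->
  strongly_admissible (Omega `\` V) nu (Ak_space Omega nu V psi k).
Proof.
move=> [Aw As]; split=> [|F AkF Fc Fu]; first exact: Ak_weakly_admissible.
have [A2 AK] := Aw; have [M M0 psiM] := psi_bounded.
have F2 j := Ak_space_in_L2 (AkF j).
have mT := measurable_msupport.
have [H HA] : {H : nat -> Cn R n -> C R & forall j, A_space Omega nu (H j) /\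
    (forall z, ((Omega `\` V) `|` T) z -> H j z = psi z ^+ k.+1 * F j z)}.
  apply: (@choice _ _ (fun j Hj => A_space Omega nu Hj /\
    (forall z, ((Omega `\` V) `|` T) z -> Hj z = psi z ^+ k.+1 * F j z))) => j.
  by have [Hj AHj HjF] := A_space_clear_denominator (AkF j); exists Hj.
(* One more power of [psi] than in [H j]: near [V] the functions [H j] are only bounded, and this
   factor supplies the smallness. *)
pose L j z := psi z * H j z.
have LA j : A_space Omega nu (L j) by apply: A_space_psiM; case: (HA j).
have LF j z : ((Omega `\` V) `|` T) z -> L j z = psi z ^+ k.+2 * F j z.
  by move=> OVT; rewrite /L (HA j).2// mulrA -exprS.
have psiXM i z : closure Omega z -> cmod (psi z ^+ i) <= M ^+ i.
  move=> cz; rewrite cmodX lerXn2r ?nnegrE ?cmod_ge0 ?(ltW M0)//; exact: psiM.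
have mF j := (F2 j).1.
(* A Cauchy sequence is bounded: beyond [N0] the norm of [F j] is at most 1 plus that of [F N0], and
   [H j] costs the factor [M ^+ k.+1]. *)
have [B B0 [N0 HB]] : exists2 B : R, 0 < B & exists N0 : nat, forall j,
    (N0 <= j)%N -> (L2norm nu T (H j) <= B%:E)%E.
  have [N0 FN0] := Fc 1 ltr01.
  have FN0fin : L2norm nu T (F N0) \is a fin_num.
    by rewrite ge0_fin_numE ?Lnorm_ge0//; case: (F2 N0).
  exists (M ^+ k.+1 * (1 + fine (L2norm nu T (F N0)))).
    by rewrite mulr_gt0 ?exprn_gt0// ltr_wpDr// fine_ge0// Lnorm_ge0.
  exists N0 => j Nj.
  apply: (@le_trans _ _ ((M ^+ k.+1)%:E * L2norm nu T (F j))%E).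
    apply: le_L2norm; rewrite ?exprn_ge0 ?ltW//.
    - by apply: measurable_cmod; case: (A2 _ (HA j).1).
    - exact: measurable_cmod.
    move=> z Tz; rewrite (HA j).2; last by right.
    by rewrite cmodM ler_wpM2r ?cmod_ge0// psiXM//; exact: msupport_sub_closure.
  rewrite EFinM lee_pmul2l ?lte_fin ?exprn_gt0// EFinD fineK//.
  apply: le_trans (L2norm_triangle _ mT _ _ (mF j) (mF N0)) _.
  by rewrite leeD2r// ltW// FN0.
have Lc : L2cauchy nu T L.
  move=> e e0; have e0' : 0 < e / M ^+ k.+2 by rewrite divr_gt0// exprn_gt0.
  have [N FN] := Fc _ e0'; exists N => i j Ni Nj.
  apply: (@le_lt_trans _ _
    ((M ^+ k.+2)%:E * L2norm nu T (fun z => F i z - F j z)%R)%E).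
    apply: le_L2norm; rewrite ?exprn_ge0 ?ltW//.
    - by apply: measurable_cmodB => //; [case: (A2 _ (LA i))|case: (A2 _ (LA j))].
    - exact: measurable_cmodB.
    move=> z Tz; rewrite !LF; try by right.
    rewrite -mulrBr cmodM ler_wpM2r ?cmod_ge0// psiXM//.
    exact: msupport_sub_closure.
  have := FN i j Ni Nj.
  rewrite -(@lte_pmul2l _ (M ^+ k.+2)%:E) ?lte_fin ?exprn_gt0//.
  by rewrite -EFinM mulrC divfK// expf_neq0// gt_eqF.
have Lu (K : set (Cn R n)) : compact K -> K `<=` Omega ->
    {uniform K, L @ \oo --> (fun=> 0 : C R)}.
  move=> cK KO; apply/uniform_cvg0P => e e0.
  have [CK CK0 CKA] := AK K cK KO.
  (* Chosen so that [|psi| < d] and [|H j| <= CK * B] give [|L j| <= e / 2]. *)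
  pose d := e / (2 * (CK * B)).
  have d0 : 0 < d by rewrite divr_gt0 ?mulr_gt0.
  pose U := [set z | Omega z /\ cmod (psi z) < d].
  have oU : open U.
    rewrite openE => z [Oz pz]; apply: filterI; first exact: open_nbhs_nbhs.
    have cz : {for z, continuous (cmod \o psi)}.
      apply: continuous_comp; last exact: continuous_cmod.
      exact/differentiable_continuous/dpsi/subset_closure.
    exact: cvgr_lt cz _ pz.
  (* [U] contains all points of [K] in [V], so the rest of [K] is a compact subset of [Omega] off
     [V], where the assumed uniform convergence applies. *)
  have cKU : compact (K `&` ~` U) by apply: compact_closedI => //; exact: open_closedC.
  have KUO : K `&` ~` U `<=` Omega `\` V.
    move=> z [/KO Oz nUz]; split=> // Vz; apply: nUz; split=> //.
    by rewrite ((psi0 _ (subset_closure Oz)).1 Vz) cmod0.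
  have /uniform_cvg0P FU := Fu _ cKU KUO.
  (* Compensates the bound [M ^+ k.+2] of the factor in [L j = psi ^+ k.+2 * F j] off [U]. *)
  have eM : 0 < e / M ^+ k.+2 by rewrite divr_gt0// exprn_gt0.
  have [N1 FN1] := FU _ eM.
  exists (maxn N0 N1) => j; rewrite geq_max => /andP[N0j N1j] z Kz.
  have [Uz|nUz] := pselect (U z); last first.
    rewrite LF; last by left; apply: KUO.
    rewrite cmodM; have := FN1 j N1j z (conj Kz nUz).
    rewrite ltr_pdivlMr ?exprn_gt0// => /(le_lt_trans _); apply.
    rewrite mulrC ler_wpM2l ?cmod_ge0// psiXM//; exact/subset_closure/KO.
  have Hz : cmod (H j z) <= CK * B.
    rewrite -lee_fin EFinM; apply: le_trans (CKA _ (HA j).1 _ Kz) _.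
    by rewrite lee_pmul2l ?lte_fin// HB.
  rewrite /L cmodM; apply: (@le_lt_trans _ _ (d * (CK * B))).
    by apply: ler_pM; rewrite ?cmod_ge0//; case: Uz => _ /ltW.
  have -> : d * (CK * B) = e / 2 by rewrite /d; field; rewrite !gt_eqF.
  by rewrite gtr_pMr// invf_lt1// ltr1n.
have := As L LA Lc Lu.
move/(ereal_cvg0P (fun j => Lnorm_ge0 _ _ _)) => L0.
apply/(ereal_cvg0P (fun j => Lnorm_ge0 _ _ _)).
apply: (@L2norm_cvg0_divide _ _ nu _ mT (fun z => psi z ^+ k.+2)) => //.
- exact: measurable_cmod_psiX.
(* Zeros of [psi ^+ k.+2] on [T] lie in [V], where the extension by zero makes every [F j]
   vanish. *)
- move=> z Tz /eqP; rewrite expf_eq0/= => /eqP pz j.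
  have [_ _] := AkF j; apply; split=> //.
  by apply/psi0 => //; exact: msupport_sub_closure.
- move=> e e0; have [N LN] := L0 e e0; exists N => j Nj.
  apply: le_lt_trans (LN j Nj).
  rewrite -[leRHS]mul1e; apply: le_L2norm => //.
  - by apply: measurable_cmodM; [exact: measurable_cmod_psiX|exact: measurable_cmod].
  - by apply: measurable_cmod; case: (A2 _ (LA j)).
  - by move=> z Tz; rewrite mul1r LF//; right.
Qed.

End admissible_division.

(** * From germs to functions on the closure of the domain *)

Lemma zero_set_germP {R : realType} {n : nat} {K : set (Cn R n)}
    {psi : hol_germ K} {V : hyp_germ K} : zero_set_germ psi V ->
  forall z, K z -> vg_set V z <-> psi z = 0.
Proof.
move=> [W [_ KW _ /seteqP[WV0 W0V]]] z /KW Wz; split=> [Vz|pz].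
  by have [] := WV0 z (conj Wz Vz).
by have [] := W0V z (conj Wz pz).
Qed.

Theorem theorem3p12 (R : realType) (n : nat) (Omega : set (Cn R n))
    (nu : {finite_measure set (borel (Cn R n)) -> \bar R})
    (V : hyp_germ (closure Omega)) :
  is_domain Omega -> relatively_compact Omega ->
  carried_by nu (boundary Omega) ->
  hyp_irreducible V -> minimally_defined V ->
  (Omega `&` V) !=set0 ->
  nu (msupport nu `&` V) = 0%E ->
  forall psi : hol_germ (closure Omega), minimal_defining V psi ->
  (weakly_admissible Omega nu (A_space Omega nu) ->
     forall k : nat,
       weakly_admissible (Omega `\` V) nu (Ak_space Omega nu V psi k)) /\
  (strongly_admissible Omega nu (A_space Omega nu) ->
     forall k : nat,
       strongly_admissible (Omega `\` V) nu (Ak_space Omega nu V psi k)).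
Proof.
move=> [_ oOmega _] cOmega nuOmega _ _ _ _ psi [psiV _].
(* The representative of [psi] is holomorphic on a neighborhood of the closure and cuts out [V]
   there, so both facts hold up to the boundary, in particular on [T]. *)
have psi0 := zero_set_germP psiV.
have dpsi z : closure Omega z -> differentiable psi z.
  by move=> cz; exact: (@hg_hol _ _ _ psi z (@hg_sub _ _ _ psi z cz)).
by split=> [Aw|As] k; [apply: Ak_weakly_admissible|apply: Ak_strongly_admissible].
Qed.
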